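(* For $0<k<n$, \[D(n,k)=(k+1)D(n-1,k)+(n-k)D(n-1,k-1)+k\widetilde{D}(n-1,k)+(n-k+1)\widetilde{D}(n-1,k-1),\] \[\widetilde{D}(n,k)=(k+1)\widetilde{D}(n-1,k)+(n-k)\widetilde{D}(n-1,k-1)+kD(n-1,k)+(n-k+1)D(n-1,k-1),\] and the boundary values are $D(n,0)=1$, $\widetilde{D}(n,0)=0$, $D(n,n)=1$ if $n$ is even and $0$ if $n$ is odd, $\widetilde{D}(n,n)=0$ if $n$ is even and $1$ if $n$ is odd.
   Context: $\mathcal{B}_n$ is the group of permutations $\sigma$ of $\{-n,\dots,n\}$ with $\sigma(-k)=-\sigma(k)$ for all $k$. For $\sigma\in\mathcal{B}_n$, $\mathrm{desc}(\sigma)$ is the number of $i\in\{0,\dots,n-1\}$ with $\sigma(i)>\sigma(i+1)$ (descends of $(0,\sigma(1),\dots,\sigma(n))$). $\mathcal{D}_n$ is the set of $\sigma\in\mathcal{B}_n$ such that $\{\sigma(1),\dots,\sigma(n)\}$ contains an even number of negative elements, and $\widetilde{\mathcal{D}}_n=\mathcal{B}_n\setminus\mathcal{D}_n$. $D(n,k)=\#\{\sigma\in\mathcal{D}_n:\mathrm{desc}(\sigma)=k\}$ and $\widetilde{D}(n,k)=\#\{\sigma\in\widetilde{\mathcal{D}}_n:\mathrm{desc}(\sigma)=k\}$, for $n\ge0$, $0\le k\le n$. *)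

(* Defs.v *)
From mathcomp Require Import all_boot all_fingroup.

Set Implicit Arguments.
Unset Strict Implicit.
Unset Printing Implicit Defensive.

(* The integers -n, ..., n are encoded, in increasing order, by the ordinals
   0, ..., 2n of 'I_(n + n.+1): the ordinal x stands for the integer x - n.
   Hence rev_ord is negation, comparing ordinals is comparing integers, an
   ordinal x is negative when x < n, and rshift n i stands for i >= 0. *)
Definition signed_index (n : nat) := 'I_(n + n.+1).

Definition Bset (n : nat) : {set {perm signed_index n}} :=
  [set s : {perm signed_index n} | [forall x, s (rev_ord x) == rev_ord (s x)]].

Definition pos (n : nat) (i : 'I_n.+1) : signed_index n := rshift n i.

(* For i : 'I_n, lift ord0 i has value i + 1. *)
Definition desc (n : nat) (s : {perm signed_index n}) : nat :=
  #|[set i : 'I_n | s (pos (widen_ord (leqnSn n) i)) > s (pos (lift ord0 i))]|.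

Definition positive_images (n : nat) (s : {perm signed_index n}) :
    {set signed_index n} :=
  [set s (pos i) | i : 'I_n.+1 & 0 < i].

Definition Dset (n : nat) : {set {perm signed_index n}} :=
  [set s in Bset n | ~~ odd #|[set x in positive_images s | x < n]|].

Definition Dtset (n : nat) : {set {perm signed_index n}} := Bset n :\: Dset n.

Definition D (n k : nat) : nat := #|[set s in Dset n | desc s == k]|.

Definition Dt (n k : nat) : nat := #|[set s in Dtset n | desc s == k]|.

(* Main.v *)
(** Write a signed permutation as the word [s(1) ... s(n)] of integers.  Every
    word of size [n] arises exactly once by inserting [n] or [-n] into a word of
    size [n-1], and deleting letters of maximal absolute value undoes this.  Let
    the shorter word, preceded by the letter 0, have [d] descents.  Inserting
    [n] keeps [d] when done inside a descent or at the end ([d+1] places) and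
    adds one descent otherwise; inserting [-n] flips the parity of the number of
    negative letters, keeps [d] when done inside a descent ([d] places), and adds
    one descent otherwise. *)

Require Import Defs.
From mathcomp Require Import all_boot all_order all_fingroup all_algebra.
From mathcomp Require Import zify.

Import Order.TTheory GRing.Theory Num.Theory.

Set Implicit Arguments.
Unset Strict Implicit.
Unset Printing Implicit Defensive.

(** * Descents of words under insertion of an extreme letter *)

Fixpoint descents (x : int) (w : seq int) : nat :=
  if w is y :: w' then (y < x)%R + descents y w' else 0.

Fixpoint insertions (v : int) (w : seq int) : seq (seq int) :=
  (v :: w) :: (if w is y :: w' then map (cons y) (insertions v w') else [::]).

Definition num_neg (w : seq int) : nat := count (fun y => y < 0)%R w.

Definition insert_both (n : nat) (w : seq int) : seq (seq int) :=
  insertions (Posz n) w ++ insertions (- Posz n)%R w.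

Fixpoint signed_words (n : nat) : seq (seq int) :=
  if n is m.+1 then flatten (map (insert_both m.+1) (signed_words m))
  else [:: [::]].

Lemma descents_le_size x w : descents x w <= size w.
Proof. by elim: w x => //= y w IH x; rewrite -add1n leq_add ?leq_b1. Qed.

(** [Q] is arbitrary because the induction puts a letter [y] in front, which shifts the descent
    number by [(y < x)%R]; the inner count then uses the shifted predicate. Inserting [v] before [y]
    replaces the comparison of [x] with [y] by a non-descent followed by a descent. *)
Lemma count_descents_insert_max (Q : pred nat) (v x : int) (w : seq int) :
  (x <= v)%R -> all (fun y => y < v)%R w ->
  count (fun u => Q (descents x u)) (insertions v w) =
  Q (descents x w) * (descents x w).+1
  + Q (descents x w).+1 * (size w - descents x w).
Proof.
elim: w Q x => [|y w IH] Q x xv /=.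
  by rewrite [(v < x)%R]ltNge xv /= muln0 muln1.
case/andP=> yv wv; rewrite [(v < x)%R]ltNge xv yv /= count_map.
rewrite (IH (fun d => Q ((y < x)%R + d)) y (ltW yv) wv).
have := descents_le_size y w; set d := descents y w => dw.
case: (y < x)%R; rewrite !add0n ?add1n;
  by case: (Q d); case: (Q d.+1); case: (Q d.+2); lia.
Qed.

(** Dual count: a minimal letter always makes a descent with its predecessor and never with its
    successor, so the end of the word is now a place that adds a descent. *)
Lemma count_descents_insert_min (Q : pred nat) (v x : int) (w : seq int) :
  (v < x)%R -> all (fun y => v < y)%R w ->
  count (fun u => Q (descents x u)) (insertions v w) =
  Q (descents x w) * descents x w
  + Q (descents x w).+1 * (size w - descents x w).+1.
Proof.
elim: w Q x => [|y w IH] Q x vx /=.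
  by rewrite vx /= muln0 muln1 addn0.
case/andP=> vy vw; rewrite vx [(y < v)%R]ltNge (ltW vy) /= count_map.
rewrite (IH (fun d => Q ((y < x)%R + d)) y vy vw).
have := descents_le_size y w; set d := descents y w => dw.
case: (y < x)%R; rewrite !add0n ?add1n;
  by case: (Q d); case: (Q d.+1); case: (Q d.+2); lia.
Qed.

(** * Each signed word is listed exactly once *)

Lemma mem_insertions v w u :
  reflect (exists2 p, w = p.1 ++ p.2 & u = p.1 ++ v :: p.2)
          (u \in insertions v w).
Proof.
apply: (iffP idP) => [|[[a b] /= -> ->]]; last first.
  elim: a => [|y a IH] /=; first by case: b => [|? ?]; rewrite inE eqxx.
  by rewrite inE map_f ?orbT.
elim: w u => [|y w IH] u /=; rewrite inE.
  by move/eqP->; exists ([::], [::]).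
case/orP=> [/eqP->|]; first by exists ([::], y :: w).
by case/mapP=> u' /IH [[a b] /= -> ->] ->; exists (y :: a, b).
Qed.

Lemma perm_insertions v w u : u \in insertions v w -> perm_eq u (v :: w).
Proof. by case/mem_insertions=> -[a b] /= -> ->; rewrite perm_catC /= perm_cons perm_catC. Qed.

Lemma uniq_insertions v w : v \notin w -> uniq (insertions v w).
Proof.
elim: w => [|y w IH] //=; rewrite inE negb_or => /andP[vy vw].
rewrite map_inj_uniq ?IH ?andbT => [|//|a b []//].
by apply/mapP=> -[u _ [/eqP]]; rewrite (negPf vy).
Qed.

(** Since [g] recovers the index of the block containing an element, blocks with distinct indices
    are disjoint. *)
Lemma uniq_flatten_map (S T : eqType) (g : T -> S) (F : S -> seq T) s :
  uniq s -> {in s, forall w, uniq (F w)} ->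
  {in s, forall w, {in F w, forall u, g u = w}} -> uniq (flatten (map F s)).
Proof.
elim: s => //= w s IH /andP[ws us] uF gF.
rewrite cat_uniq uF ?mem_head //=; apply/andP; split; last first.
  by apply: IH => // z zs; [apply: uF|apply: gF]; rewrite inE zs orbT.
apply/hasPn => u /flatten_mapP [z zs uz]; apply/negP => uw.
have zw : z = w.
  by rewrite -(gF z _ u uz) ?(gF w _ u uw) // inE ?zs ?eqxx ?orbT.
by rewrite -zw zs in ws.
Qed.

Lemma mem_signed_words n w :
  (w \in signed_words n) = perm_eq (map absz w) (iota 1 n).
Proof.
elim: n w => [|n IH] w.
  by rewrite inE; case: w => //= y w; apply/esym/negbTE/negP => /perm_size.
rewrite [signed_words _]/=.
have iotaE : perm_eq (n.+1 :: iota 1 n) (iota 1 n.+1).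
  have -> : iota 1 n.+1 = rcons (iota 1 n) n.+1.
    by rewrite -cats1 -[in LHS](addn1 n) iotaD add1n.
  by rewrite perm_sym perm_rcons.
apply/flatten_mapP/idP => [[z]|pw].
  rewrite IH mem_cat => pz.
  case/orP=> /perm_insertions/(perm_map absz)/permPl ->;
    by rewrite map_cons ?abszN -(permPr iotaE) perm_cons.
(* Deleting this letter of maximal absolute value leaves the shorter word [a ++ b]; its sign tells
   which half of [insert_both] gives [w] back. *)
have [v vw vn] : exists2 v, v \in w & absz v = n.+1.
  have : n.+1 \in map absz w by rewrite (perm_mem pw) mem_iota; lia.
  by case/mapP=> v vw ->; exists v.
case/splitPr: vw pw => a b pw; exists (a ++ b).
  rewrite IH -(perm_cons n.+1) (permPr iotaE) -(permPr pw) !map_cat /= vn.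
  by rewrite perm_sym perm_catC /= perm_cons perm_catC.
rewrite mem_cat; apply/orP.
have [->|->] : v = Posz n.+1 \/ v = (- Posz n.+1)%R by lia.
  by left; apply/mem_insertions; exists (a, b).
by right; apply/mem_insertions; exists (a, b).
Qed.

Lemma signed_word_bound n w v : w \in signed_words n -> v \in w -> 0 < absz v <= n.
Proof.
rewrite mem_signed_words => /perm_mem pw vw.
by have := pw (absz v); rewrite map_f // mem_iota; lia.
Qed.

Lemma size_signed_word n w : w \in signed_words n -> size w = n.
Proof. by rewrite mem_signed_words => /perm_size; rewrite size_map size_iota. Qed.

Lemma uniq_signed_words n : uniq (signed_words n).
Proof.
elim: n => //= n IH.
(* Filtering out the letters of absolute value above [n] undoes the insertion, whichever sign was
   inserted. *)
apply: (@uniq_flatten_map _ _ (filter (fun y => absz y <= n))) => // w wn.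
  have out v : absz v = n.+1 -> v \notin w.
    by move=> vn; apply/negP => /(signed_word_bound wn); lia.
  rewrite cat_uniq !uniq_insertions ?out //= ?abszN //= andbT.
  (* The two insertion lists are disjoint: [- Posz n.+1] occurs in every word of the second and in
     none of the first. *)
  apply/hasPn => u /perm_insertions/perm_mem pu; apply/negP.
  move/perm_insertions/perm_mem/(_ (- Posz n.+1)%R).
  rewrite pu !inE eqxx (negPf (out _ _)) ?abszN //= orbF => /esym/eqP; lia.
have keep (s : seq int) : {subset s <= w} -> filter (fun y => absz y <= n) s = s.
  move=> sw; apply/all_filterP/allP => y /sw /(signed_word_bound wn); lia.
by move=> u; rewrite mem_cat => /orP[] /mem_insertions[[a b] /= wE ->];
  rewrite filter_cat /= ?abszN /= ltnn -filter_cat -wE keep.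
Qed.

(** * Recurrence and boundary values for the word counts *)

Definition num_words (b : bool) (n k : nat) : nat :=
  count (fun w => (odd (num_neg w) == b) && (descents 0 w == k)) (signed_words n).

Lemma num_neg_insertion v w u :
  u \in insertions v w -> num_neg u = (v < 0)%R + num_neg w.
Proof. by rewrite /num_neg => /perm_insertions/seq.permP ->. Qed.

(** The numbers of places are expressed through the target [k]: a word reaches it either by keeping
    its [k] descents or by gaining one. Inserting the negative letter flips the parity, hence the
    terms with [~~ b]. *)
Lemma count_insert_both b n k w : w \in signed_words n ->
  count (fun u => (odd (num_neg u) == b) && (descents 0 u == k))
    (insert_both n.+1 w) =
  (odd (num_neg w) == b) *
    ((descents 0 w == k) * k.+1 + ((descents 0 w).+1 == k) * (n.+1 - k))
  + (odd (num_neg w) == ~~ b) *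
    ((descents 0 w == k) * k + ((descents 0 w).+1 == k) * (n.+1 - k).+1).
Proof.
move=> wn; have bound := signed_word_bound wn.
have lew : descents 0 w <= n by rewrite -(size_signed_word wn) descents_le_size.
(* All insertions of [v] have equally many negative letters, so the parity test factors out of the
   count. *)
have splitQ (c : bool) (v : int) : (v < 0)%R = c ->
  count (fun u => (odd (num_neg u) == b) && (descents 0 u == k)) (insertions v w) =
  (odd (num_neg w) == b (+) c) *
    count (fun u => descents 0 u == k) (insertions v w).
  move=> vc; transitivity (count (fun u => (odd (num_neg w) == b (+) c)
      && (descents 0 u == k)) (insertions v w)).
    apply: eq_in_count => u /num_neg_insertion ->.
    by rewrite vc oddD oddb; case: c {vc}; case: (b); case: (odd _).
  by case: (_ == _); rewrite ?mul1n ?mul0n //= count_pred0.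
rewrite count_cat (splitQ false) ?(splitQ true) // addbF addbT.
rewrite (count_descents_insert_max (pred1 k)) //; last first.
  by apply/allP => y /bound; lia.
rewrite (count_descents_insert_min (pred1 k)) //; last first.
  by apply/allP => y /bound; lia.
rewrite (size_signed_word wn) /=; congr (_ * _ + _ * _);
  by case: eqP; case: eqP; lia.
Qed.

Lemma num_wordsE b n k :
  num_words b n k =
  \sum_(w <- signed_words n) (odd (num_neg w) == b) * (descents 0 w == k).
Proof.
by rewrite /num_words -sum1_count big_mkcond; apply: eq_bigr => w _; case: eqP; case: eqP.
Qed.

Lemma num_wordsS b n k :
  num_words b n.+1 k.+1 =
  k.+2 * num_words b n k.+1 + (n - k) * num_words b n k
  + k.+1 * num_words (~~ b) n k.+1 + (n - k).+1 * num_words (~~ b) n k.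
Proof.
rewrite {1}/num_words /= count_flatten -map_comp sumnE big_map.
rewrite !num_wordsE !big_distrr -!big_split /=.
apply: eq_big_seq => w wn; rewrite [LHS]count_insert_both // eqSS subSS; lia.
Qed.

Lemma num_wordsS0 b n : num_words b n.+1 0 = num_words b n 0.
Proof.
rewrite {1}/num_words /= count_flatten -map_comp sumnE big_map num_wordsE.
by apply: eq_big_seq => w wn; rewrite [LHS]count_insert_both //=; lia.
Qed.

Lemma num_words_gt b n k : n < k -> num_words b n k = 0.
Proof.
move=> nk; apply/eqP; rewrite -leqn0 leqNgt -has_count.
apply/hasPn => w /size_signed_word sw; rewrite negb_and.
by have := descents_le_size 0 w; rewrite sw; case: eqP => /=; lia.
Qed.

Lemma num_words0 b n : num_words b n 0 = ~~ b.
Proof. by elim: n => [|n IH]; rewrite ?num_wordsS0 //; case: b. Qed.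

(** On the diagonal of the recurrence only the last term survives, with coefficient 1: the others
    carry a count with more descents than letters or the factor [n - n]. It exchanges [b] and
    [~~ b], so the value alternates with [n]. *)
Lemma num_words_diag b n : num_words b n n = (odd n == b).
Proof.
elim: n b => [|n IH] b; first by case: b.
rewrite num_wordsS !(num_words_gt _ (ltnSn n)) !IH subnn !muln0 !add0n mul1n /=.
by case: b; case: (odd n).
Qed.

(** * Bijection between signed permutations and signed words *)

Definition word (n : nat) (s : {perm signed_index n}) : seq int :=
  [seq (Posz (s (pos (lift ord0 i))) - Posz n)%R | i <- enum 'I_n].

Lemma size_word n (s : {perm signed_index n}) : size (word s) = n.
Proof. by rewrite size_map size_enum_ord. Qed.

Lemma nth_word n (s : {perm signed_index n}) (i : 'I_n) :
  nth 0%R (word s) i = (Posz (s (pos (lift ord0 i))) - Posz n)%R.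
Proof. by rewrite (nth_map i) ?size_enum_ord // nth_ord_enum. Qed.

Lemma val_pos n (i : 'I_n.+1) : pos i = n + i :> nat.
Proof. by []. Qed.

Lemma val_rev n (x : signed_index n) : rev_ord x = n.*2 - x :> nat.
Proof. by rewrite /=; lia. Qed.

Lemma BsetP n (s : {perm signed_index n}) :
  reflect (forall x, s (rev_ord x) = rev_ord (s x)) (s \in Bset n).
Proof. by rewrite inE; apply: (iffP forallP) => h x; apply/eqP; rewrite // h. Qed.

(** The image of 0 equals its own negative, and 0 is the only such integer. *)
Lemma Bset_pos0 n (s : {perm signed_index n}) :
  s \in Bset n -> s (pos ord0) = pos ord0.
Proof.
move/BsetP/(_ (pos ord0)).
have -> : rev_ord (pos ord0) = pos ord0 :> signed_index n.
  by apply: val_inj; rewrite /= ; lia.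
move/(congr1 val) => /= sE; apply: val_inj => /=.
by have := ltn_ord (s (pos ord0)); lia.
Qed.

Lemma descents_sum x w :
  descents x w = \sum_(i < size w) (nth 0 w i < nth 0 (x :: w) i)%R.
Proof.
by elim: w x => [|y w IH] x; rewrite ?big_ord0 // big_ord_recl /= IH.
Qed.

Lemma descents_word n (s : {perm signed_index n}) :
  s \in Bset n -> descents 0 (word s) = desc s.
Proof.
move=> sB; rewrite descents_sum size_word /desc -sum1dep_card [RHS]big_mkcond.
apply: eq_bigr => i _; rewrite nth_word.
(* The leading 0 of the word stands for [s(0)], which is 0 by [Bset_pos0]; later letters are shifted
   by one position. *)
have -> : nth 0%R (0%R :: word s) i =
    (Posz (s (pos (widen_ord (leqnSn n) i))) - Posz n)%R.
  case: i => [[|i] iP].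
    have -> : widen_ord (leqnSn n) (Ordinal iP) = ord0 by apply: val_inj.
    by rewrite (Bset_pos0 sB) /= ; lia.
  rewrite -[RHS](_ : nth 0%R (word s) (Ordinal (ltnW iP)) = _) //.
  rewrite nth_word (_ : lift _ _ = widen_ord (leqnSn n) (Ordinal iP)) //.
  by apply: val_inj.
by rewrite ltrD2r ltz_nat; case: ltnP.
Qed.

(** Distinct positions carry distinct values, so the cardinal of a set of values is a count of
    letters. *)
Lemma num_neg_word n (s : {perm signed_index n}) :
  num_neg (word s) = #|[set x in positive_images s | x < n]|.
Proof.
pose f (i : 'I_n) := s (pos (lift ord0 i)).
have f_inj : injective f.
  by move=> i j /perm_inj/(@rshift_inj n n.+1)/lift_inj.
have -> : [set x in positive_images s | x < n] =
          f @: [set i : 'I_n | f i < n].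
  apply/setP => x; rewrite inE; apply/andP/imsetP.
    case=> /imsetP[i]; rewrite inE => i0 -> xn.
    case: (unliftP ord0 i) i0 xn => [j ->|->//] _ jn.
    by exists j; rewrite ?inE.
  case=> j; rewrite inE => jn ->; split=> //.
  by apply/imsetP; exists (lift ord0 j); rewrite ?inE.
rewrite card_imset // /num_neg count_map cardsE cardE -size_filter.
rewrite enumT /enum_mem; congr (size _); apply: eq_filter => i /=.
by rewrite unfold_in /f; lia.
Qed.

(** The word fixes the values at positive arguments, 0 is fixed, and oddness yields the negative
    arguments. *)
Lemma Bset_word_inj n : {in Bset n &, injective (@word n)}.
Proof.
move=> s t sB tB st; apply/permP.
have eq_pos (i : 'I_n.+1) : s (pos i) = t (pos i).
  case: (unliftP ord0 i) => [j ->|->]; last by rewrite !Bset_pos0.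
  apply: val_inj => /=; move/(congr1 (nth 0%R ^~ j)): st.
  by rewrite !nth_word; lia.
have eq_ge (x : signed_index n) : n <= x -> s x = t x.
  move=> nx; have xP : x - n < n.+1 by have := ltn_ord x; lia.
  have -> : x = pos (Ordinal xP) by apply: val_inj => /=; lia.
  exact: eq_pos.
move=> x; have [/eq_ge//|xn] := leqP n x.
apply: rev_ord_inj; rewrite -(BsetP _ sB) -(BsetP _ tB); apply: eq_ge.
by rewrite val_rev; lia.
Qed.

Lemma word_signed_words n (s : {perm signed_index n}) :
  s \in Bset n -> word s \in signed_words n.
Proof.
move=> sB; rewrite mem_signed_words.
have wU : uniq (map absz (word s)).
  rewrite -map_comp map_inj_in_uniq ?enum_uniq // => i j _ _ /= ij.
  (* Equal absolute values mean equal or opposite images; opposite ones would force two positive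
     arguments to be opposite. *)
  have [/ord_inj/perm_inj/(@rshift_inj n n.+1)/lift_inj//|] :
    s (pos (lift ord0 i)) = s (pos (lift ord0 j)) :> nat \/
    s (pos (lift ord0 i)) = rev_ord (s (pos (lift ord0 j))) :> nat.
  - rewrite val_rev; have := ltn_ord (s (pos (lift ord0 i))).
    by have := ltn_ord (s (pos (lift ord0 j))); lia.
  - rewrite -(BsetP _ sB) => /ord_inj/perm_inj/(congr1 val) /=.
    by rewrite /bump /=; have := ltn_ord i; have := ltn_ord j; lia.
apply: uniq_perm; rewrite ?iota_uniq //.
(* The [n] distinct absolute values fill [iota 1 n] as soon as they all lie in it. *)
have [||//] := uniq_min_size wU (s2 := iota 1 n); last first.
  by rewrite size_map size_word size_iota.
move=> _ /mapP[_ /mapP[i _ ->] ->]; rewrite mem_iota.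
have := ltn_ord (s (pos (lift ord0 i))).
(* The ordinal [n] encodes 0, which is already the image of 0. *)
suff : nat_of_ord (s (pos (lift ord0 i))) != n by rewrite /=; lia.
apply/eqP => sn; have /perm_inj/(congr1 val) : s (pos (lift ord0 i)) = s (pos ord0).
  by rewrite Bset_pos0 //; apply: ord_inj; rewrite sn /= addn0.
by rewrite /= /bump /=; lia.
Qed.

Lemma word_onto n (w : seq int) :
  w \in signed_words n -> exists2 s, s \in Bset n & word s = w.
Proof.
move=> wW; have wn := size_signed_word wW.
have wP (k : nat) : k < n -> 0 < absz (nth 0%R w k) <= n.
  by move=> kn; apply: (signed_word_bound wW); rewrite mem_nth ?wn.
have wU : uniq (map absz w).
  by move: wW; rewrite mem_signed_words => /perm_uniq ->; apply: iota_uniq.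
have winj (k l : nat) : k < n -> l < n ->
    absz (nth 0%R w k) = absz (nth 0%R w l) -> k = l.
  move=> kn ln; rewrite -!(nth_map 0%R 0 absz) ?wn // => /eqP.
  by rewrite nth_uniq ?size_map ?wn // => /eqP.
(* The odd extension of [w] to all integers: the factor [sgz z] gives 0 at 0, and [.-1] turns the
   argument into a list index starting at 0. *)
pose h (z : int) : int := (sgz z * nth 0%R w (absz z).-1)%R.
have hN z : (h (- z) = - h z)%R by rewrite /h sgzN abszN mulNr.
have hP z : absz z <= n -> absz (h z) <= n.
  by move=> zn; rewrite /h; case: sgzP => z0; rewrite ?mul0r ?mul1r ?mulN1r ?abszN //;
     have := wP (absz z).-1; lia.
have h0 : h 0%R = 0%R by rewrite /h sgz0 mul0r.
have habs z : z != 0%R -> absz (h z) = absz (nth 0%R w (absz z).-1).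
  by move=> z0; rewrite /h abszM absz_sg z0 mul1n.
have hgt0 z : z != 0%R -> absz z <= n -> 0 < absz (h z).
  by move=> z0 zn; rewrite habs //; have := wP (absz z).-1; lia.
have hinj y z : absz y <= n -> absz z <= n -> h y = h z -> y = z.
  move=> yn zn hyz; have [y0|y0] := eqVneq y 0%R.
    by apply/eqP; apply: contraT; rewrite y0 eq_sym => /hgt0/(_ zn);
       rewrite -hyz y0 h0.
  have [z0|z0] := eqVneq z 0%R; first by move: (hgt0 y y0 yn); rewrite hyz z0 h0.
  have yz : (absz y).-1 = (absz z).-1.
    by apply: winj; [lia|lia|rewrite -!habs // hyz].
  (* The case [y = - z] is impossible: it would give [h z = - h z] with [h z] nonzero. *)
  have [//|yNz] : y = z \/ y = (- z)%R by lia.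
  by have := hgt0 z z0 zn; move: hyz; rewrite yNz hN; lia.
(* [h] read through the shift by [n]. By [hP] the shifted value lies between 0 and [2n], so [absz]
   and [insubd] preserve it, as [fE] records. *)
pose f (x : signed_index n) : signed_index n :=
  insubd x (absz (h (Posz x - Posz n) + Posz n)%R).
have fE x : (Posz (f x) = h (Posz x - Posz n) + Posz n)%R.
  have := hP (Posz x - Posz n)%R; have := ltn_ord x => xn.
  by rewrite val_insubd; case: ltnP; lia.
have f_inj : injective f.
  move=> x y fxy; apply: val_inj => /=.
  have := fE x; have := fE y; rewrite fxy => ->.
  have := hinj (Posz y - Posz n)%R (Posz x - Posz n)%R.
  by have := ltn_ord x; have := ltn_ord y; lia.
exists (perm f_inj).
  apply/BsetP => x; rewrite !permE; apply: ord_inj; rewrite val_rev.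
  have := fE x; have := fE (rev_ord x); have := ltn_ord (f x); rewrite val_rev.
  have -> : (Posz (n.*2 - x) - Posz n = - (Posz x - Posz n))%R.
    by have := ltn_ord x; lia.
  by rewrite hN; lia.
apply: (@eq_from_nth _ 0%R); rewrite size_word ?wn // => k kn.
rewrite (nth_word _ (Ordinal kn)) permE fE addrK val_pos /= /bump /= add1n.
by rewrite /h (_ : (_ - _)%R = Posz k.+1) ?sgz_gt0 ?mul1r //; lia.
Qed.

Lemma perm_word n : perm_eq (map (@word n) (enum (Bset n))) (signed_words n).
Proof.
apply: uniq_perm; rewrite ?uniq_signed_words //.
  by rewrite map_inj_in_uniq ?enum_uniq // => s t; rewrite !mem_enum; apply: Bset_word_inj.
move=> w; apply/mapP/idP => [[s]|/word_onto[s sB <-]].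
  by rewrite mem_enum => /word_signed_words ? ->.
by exists s; rewrite ?mem_enum.
Qed.

(** Both statistics are read off the word, so the bijection [perm_word] carries the count over to
    signed permutations. *)
Lemma num_words_card b n k :
  num_words b n k =
  #|[set s in Bset n | (odd #|[set x in positive_images s | x < n]| == b)
                       && (desc s == k)]|.
Proof.
rewrite /num_words -(seq.permP (perm_word n)) count_map -sum1_count.
rewrite big_enum_cond -sum1dep_card; apply: eq_bigl => s.
by case sB: (s \in Bset n); rewrite //= num_neg_word descents_word.
Qed.

Lemma D_num_words n k : D n k = num_words false n k.
Proof.
rewrite num_words_card; apply: eq_card => s.
by rewrite !inE -andbA; case: (odd _).
Qed.

Lemma Dt_num_words n k : Dt n k = num_words true n k.
Proof.
rewrite num_words_card; apply: eq_card => s.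
by rewrite !inE; case: [forall x, _]; case: (odd _).
Qed.

Theorem theorem4p2 (n : nat) :
  (forall k : nat, 0 < k < n ->
     D n k = (k + 1) * D (n - 1) k + (n - k) * D (n - 1) (k - 1)
             + k * Dt (n - 1) k + (n - k + 1) * Dt (n - 1) (k - 1)
  /\ Dt n k = (k + 1) * Dt (n - 1) k + (n - k) * Dt (n - 1) (k - 1)
             + k * D (n - 1) k + (n - k + 1) * D (n - 1) (k - 1))
  /\ D n 0 = 1
  /\ Dt n 0 = 0
  /\ D n n = (if odd n then 0 else 1)
  /\ Dt n n = (if odd n then 1 else 0).
Proof.
rewrite !D_num_words !Dt_num_words !num_words0 !num_words_diag.
split; last by case: (odd n).
case: n => [|n] [|k] //.
by move=> _; rewrite !D_num_words !Dt_num_words !num_wordsS !subn1 !addn1 subSS.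
Qed.
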